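(* Let $0<\alpha<1$, $1\le i\le k\le 3$, and $\omega^{(k,i)}(\xi)=\sum_{m\ge0}\omega^{(k,i)}_m\xi^m$ with the weights defined in the context (the series converges absolutely for $|\xi|\le 1$). Then: (i) $\omega^{(k,i)}(\xi)\ne 0$ for all $\xi\in\mathbb{C}$ with $|\xi|\le 1$, $\xi\neq 1$; (ii) $\xi=1$ is a simple zero of $\omega^{(k,i)}$: $\omega^{(k,i)}(1)=0$, and writing $\omega^{(k,i)}(\xi)=(1-\xi)\varphi^{(k,i)}(\xi)$ with $\varphi^{(k,i)}(\xi)=\sum_{n\ge0}\varphi_n\xi^n$, $\varphi_n=\sum_{m=0}^{n}\omega^{(k,i)}_m$, the series $\sum_{n\ge 0}\varphi_n$ does not converge to $0$.
   Context: Uniform grid $t_n=n\Delta t$, $\Delta t>0$, $I_j=[t_{j-1},t_j]$. For a function $u$ and integers $m\ge1$, $j$, $q$, let $p^{m}_{j,q}$ be the polynomial of degree at most $m$ interpolating $u$ at $t_{j+q-m-1},\dots,t_{j+q-1}$. For $1\le i\le k$ and $n\ge k$, let $P^{k}_{i,n}$ be the continuous piecewise polynomial on $[0,t_n]$ equal on $I_j$ to $p^{k-1}_{j,k-j}$ for $1\le j\le k-i$, to $p^{k}_{j,i}$ for $k-i+1\le j\le n-i+1$, and to $p^{k}_{j,n+1-j}$ for $n-i+2\le j\le n$, and set $D^{\alpha}_{k,i}u_n=\frac{1}{\Gamma(1-\alpha)}\int_0^{t_n}(t_n-\xi)^{-\alpha}(P^{k}_{i,n})'(\xi)\,\mathrm{d}\xi$.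 This is a linear combination of $u_0=u(t_0),\dots,u_n=u(t_n)$; for $k\le j\le n$ the coefficient of $u_j$ in $(\Delta t)^{\alpha}D^{\alpha}_{k,i}u_n$ depends only on $n-j$ and is denoted $\omega^{(k,i)}_{n-j}$; this defines $\omega^{(k,i)}_m$ for all $m\ge0$. *)

(* Defs.v *)
From HB Require Import structures.
From mathcomp Require Import all_boot all_algebra.
From mathcomp Require Import all_classical all_reals all_analysis.
From mathcomp Require Export complex.
Export numFieldTopology.Exports numFieldNormedType.Exports.
Import GRing.Theory Num.Theory.

Set Implicit Arguments.
Unset Strict Implicit.
Unset Printing Implicit Defensive.

Local Open Scope ring_scope.
Local Open Scope classical_set_scope.

Section Defs.
Variable R : realType.

Definition Gamma (s : R) : R :=
  Rintegral (@lebesgue_measure R) `]0%R, +oo[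
    (fun x => x `^ (s - 1) * expR (- x)).

Definition lagrange (x y : nat -> R) (m : nat) : {poly R} :=
  \sum_(l < m.+1) y l *:
     \prod_(r < m.+1 | r != l) ((x l - x r)^-1 *: ('X - (x r)%:P)).

Definition interp (dt : R) (u : nat -> R) (m j q : nat) : {poly R} :=
  let a := (j + q - m.+1)%N in
  lagrange (fun l => (a + l)%:R * dt) (fun l => u (a + l)%N) m.

(* The piece of P^k_{i,n} on I_j = [t_{j-1}, t_j], 1 <= j <= n. *)
Definition piece (dt : R) (u : nat -> R) (k i n j : nat) : {poly R} :=
  if (j <= k - i)%N then interp dt u k.-1 j (k - j)
  else if (j <= n - i + 1)%N then interp dt u k j i
  else interp dt u k j (n + 1 - j).

(* D^alpha_{k,i} u_n = 1/Gamma(1-alpha) int_0^{t_n} (t_n - xi)^(-alpha)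
   (P^k_{i,n})'(xi) dxi, the integral split over the intervals I_j on which
   P^k_{i,n} is a polynomial. *)
Definition DCaputo (alpha dt : R) (k i n : nat) (u : nat -> R) : R :=
  (Gamma (1 - alpha))^-1 *
  \sum_(1 <= j < n.+1)
     Rintegral (@lebesgue_measure R) `[(j.-1)%:R * dt, j%:R * dt]
       (fun xi => (n%:R * dt - xi) `^ (- alpha) * (piece dt u k i n j)^`().[xi]).

(* coefficient of u_j in (dt)^alpha D^alpha_{k,i} u_n (D is linear in the
   grid values u_0..u_n, so this is its value on the j-th unit vector). *)
Definition coefD (alpha dt : R) (k i n j : nat) : R :=
  dt `^ alpha * DCaputo alpha dt k i n (fun l => (l == j)%:R).

(* omega^{(k,i)}_m := coefficient of u_{n-m} for n - m = k (>= k), dt = 1. *)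
Definition weight (alpha : R) (k i m : nat) : R :=
  coefD alpha 1 k i (m + k) k.

End Defs.

(* Main.v *)
(* Reading time backwards from t_n, let b_r, e_r, h_r be the integrals over [0,1]
   of (r + t)^(-alpha) against 1, 1/2 - t and (1 - 3 t^2)/6, and f_r = e_r - h_r.
   Up to the factor 1/Gamma(1 - alpha),
     phi = omega / (1 - xi) = B + (1 - xi) E + (1 - xi)^2 F,
   where B is the generating function of b, and E, F are those of e, f (or shifts
   of e, -h with a modified first term, according to i); E = 0 if k = 1 and F = 0
   if k <= 2.  On the closed disk minus 1 the real part of phi is positive: b is
   convex and decreasing, so Re B >= b_0 / 2; e is decreasing, so
   Re ((1 - xi) E) >= 0; and the leading coefficient f_0 <= b_0 / 3 of F contributes
   at least - f_0 / 2 because Re (1 - xi)^2 >= - 1/2, while the other coefficients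
   of F contribute less than b_0 / 3, as h_1 < 1/24, e_1 < 1/12 and b_0 >= 1.
   At xi = 1 the terms telescope: the partial sums of phi are those of b plus
   vanishing terms, hence stay away from 0. *)

Require Import Defs.
From HB Require Import structures.
From mathcomp Require Import all_boot all_order all_algebra.
From mathcomp Require Import all_classical all_reals all_analysis.
From mathcomp Require Import complex.
From mathcomp Require Import measurable_realfun zify ring lra.
Import numFieldTopology.Exports numFieldNormedType.Exports.
Import Order.TTheory GRing.Theory Num.Theory.
Local Open Scope ring_scope.
Local Open Scope classical_set_scope.

(** * Power series with real coefficients on the closed unit disk *)

Section PowerSums.
Variable R : realType.
Implicit Types (c x y : nat -> R).

(** Coefficients of [(1 - xi) C(xi)] when [C] has coefficients [c]; the value before index 0 counts
    as 0, so the first difference is [c 0]. *)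
Definition dif c (n : nat) : R := c n - (if n is n'.+1 then c n' else 0).

Lemma sum_dif c N : \sum_(0 <= n < N.+1) dif c n = c N.
Proof.
elim: N => [|N IH]; first by rewrite big_nat1 /dif subr0.
by rewrite big_nat_recr//= IH /dif addrC subrK.
Qed.

Lemma nonincr_ge0 c : (forall n, c n.+1 <= c n) -> c @ \oo --> (0 : R) ->
  forall n, 0 <= c n.
Proof.
move=> cd c0 n.
have /nonincreasing_cvgn_ge : nonincreasing_seq c by apply/nonincreasing_seqP.
by move=> /(_ (cvgP _ c0) n); rewrite (cvg_lim _ c0).
Qed.

(** Total variation: a jump from 0 up to [c 0], then a descent that stays nonnegative. *)
Lemma sum_abs_dif c N : (forall n, c n.+1 <= c n) -> (forall n, 0 <= c n) ->
  \sum_(0 <= n < N) `|dif c n| <= 2 * c 0%N.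
Proof.
move=> cd c0; case: N => [|N]; first by rewrite big_nil mulr_ge0.
suff -> : \sum_(0 <= n < N.+1) `|dif c n| = 2 * c 0%N - c N by rewrite gerBl.
elim: N => [|N IH].
  by rewrite big_nat1 /dif subr0 ger0_norm// mulr2n mulrDl mul1r addrK.
rewrite big_nat_recr//= IH /dif ler0_norm ?subr_le0//; ring.
Qed.

Lemma sum_abs_dif1 c N : c 0%N = 0 -> (forall n, c n.+2 <= c n.+1) ->
  (forall n, 0 <= c n) -> \sum_(0 <= n < N) `|dif c n| <= 2 * c 1%N.
Proof.
move=> c00 cd c0; case: N => [|N]; first by rewrite big_nil mulr_ge0.
rewrite big_nat_recl//= {1}/dif c00 subr0 normr0 add0r.
suff -> : \sum_(0 <= n < N) `|dif c n.+1| =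
    \sum_(0 <= n < N) `|dif (fun n => c n.+1) n|.
  exact: (@sum_abs_dif (fun n => c n.+1)).
by apply: eq_bigr => -[|n] _ //; rewrite /dif c00.
Qed.

(** * Powers of a point [a + ib] of the closed disk, in real coordinates *)

Variables a b : R.
Hypothesis ab1 : a ^+ 2 + b ^+ 2 <= 1.

(** Real and imaginary parts of [(a + ib)^n], kept as two reals so that estimates remain arithmetic
    in an ordered field. *)
Fixpoint powpair (n : nat) : R * R :=
  if n is n'.+1 then
    let: (p, q) := powpair n' in (a * p - b * q, a * q + b * p)
  else (1, 0).

Let p n := (powpair n).1.
Let q n := (powpair n).2.

Lemma powpair_re n : p n.+1 = a * p n - b * q n.
Proof. by rewrite /p /q /=; case: (powpair n). Qed.

Lemma powpair_im n : q n.+1 = a * q n + b * p n.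
Proof. by rewrite /p /q /=; case: (powpair n). Qed.

Lemma powpair_norm n : p n ^+ 2 + q n ^+ 2 = (a ^+ 2 + b ^+ 2) ^+ n.
Proof.
elim: n => [|n IH]; first by rewrite /p /q /= expr0; ring.
by rewrite powpair_re powpair_im [RHS]exprS -IH; ring.
Qed.

(** Cauchy-Schwarz through Lagrange's identity: the square of [u p + v q] plus that of [u q - v p]
    is the product of the two squared norms. *)
Lemma powpair_lin u v n : u ^+ 2 + v ^+ 2 <= 1 -> `|u * p n + v * q n| <= 1.
Proof.
move=> uv; have pq : p n ^+ 2 + q n ^+ 2 <= 1.
  by rewrite powpair_norm exprn_ile1// addr_ge0 ?sqr_ge0.
have h : (u * p n + v * q n) ^+ 2 <= 1.
  have h1 : 0 <= (u * q n - v * p n) ^+ 2 by exact: sqr_ge0.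
  have h2 : (u ^+ 2 + v ^+ 2) * (p n ^+ 2 + q n ^+ 2) <= 1.
    by rewrite mulr_ile1// addr_ge0 ?sqr_ge0.
  by lra.
by rewrite -(@expr_le1 _ 2%N)// real_normK ?num_real.
Qed.

(* [X + iY] is the sum of the power series with coefficients [x] at [a + ib]. *)
Definition psum x (X Y : R) :=
  series (fun n => x n * p n) @ \oo --> X /\
  series (fun n => x n * q n) @ \oo --> Y.

Lemma psumD x y X Y X' Y' : psum x X Y -> psum y X' Y' ->
  psum (fun n => x n + y n) (X + X') (Y + Y').
Proof.
move=> [hX hY] [hX' hY']; split.
  under eq_fun do rewrite mulrDl.
  by rewrite (_ : series _ = series (fun n => x n * p n) + series (fun n => y n * p n));
    [exact: cvgD | apply/funext => N; rewrite /series/= fctE big_split].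
under eq_fun do rewrite mulrDl.
by rewrite (_ : series _ = series (fun n => x n * q n) + series (fun n => y n * q n));
  [exact: cvgD | apply/funext => N; rewrite /series/= fctE big_split].
Qed.

Lemma psumZ x k X Y : psum x X Y -> psum (fun n => k * x n) (k * X) (k * Y).
Proof.
move=> [hX hY]; split.
  rewrite (_ : series _ = (fun N => k * series (fun n => x n * p n) N)).
    exact: cvgMr.
  apply/funext => N; rewrite /series/= big_distrr/=.
  by apply: eq_bigr => n _; rewrite mulrA.
rewrite (_ : series _ = (fun N => k * series (fun n => x n * q n) N)).
  exact: cvgMr.
apply/funext => N; rewrite /series/= big_distrr/=.
by apply: eq_bigr => n _; rewrite mulrA.
Qed.

(** Multiplication of the sum by [1 - xi]. With [S_N] the partial sums for [x], those for [dif x]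
    are [S_(N+1) - xi S_N]. *)
Lemma psum_dif x X Y : psum x X Y ->
  psum (dif x) (X - (a * X - b * Y)) (Y - (a * Y + b * X)).
Proof.
move=> [hX hY].
have S (z : nat -> R) N : series z N.+1 = series z N + z N.
  by rewrite /series/= big_nat_recr.
have S0 (z : nat -> R) : series z 0%N = 0 by rewrite /series/= big_nil.
split; rewrite -cvg_shiftS /=.
  rewrite (_ : (fun n => _) = (fun N => series (fun n => x n * p n) N.+1 -
     (a * series (fun n => x n * p n) N - b * series (fun n => x n * q n) N))).
    apply: cvgB; first by rewrite (cvg_shiftS (series (fun n => x n * p n))).
    by apply: cvgB; exact: cvgMr.
  apply/funext; elim=> [|N IH]; first by rewrite !S !S0 /dif; ring.
  by rewrite S IH !S /dif powpair_re; ring.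
rewrite (_ : (fun n => _) = (fun N => series (fun n => x n * q n) N.+1 -
   (a * series (fun n => x n * q n) N + b * series (fun n => x n * p n) N))).
  apply: cvgB; first by rewrite (cvg_shiftS (series (fun n => x n * q n))).
  by apply: cvgD; exact: cvgMr.
apply/funext; elim=> [|N IH]; first by rewrite !S !S0 /dif; ring.
by rewrite S IH !S /dif powpair_im; ring.
Qed.

Lemma psum_lin x X Y u v : psum x X Y ->
  series (fun n => x n * (u * p n + v * q n)) @ \oo --> u * X + v * Y.
Proof.
move=> [hX hY].
rewrite (_ : series _ = (fun N => u * series (fun n => x n * p n) N +
                                  v * series (fun n => x n * q n) N)).
  by apply: cvgD; exact: cvgMr.
apply/funext => N; rewrite /series/= !big_distrr/= -big_split/=.
by apply: eq_bigr => n _; ring.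
Qed.

Lemma psum_le x X Y u v l : psum x X Y ->
  (forall N, \sum_(0 <= n < N) x n * (u * p n + v * q n) <= l) ->
  u * X + v * Y <= l.
Proof.
move=> /(@psum_lin _ _ _ u v) h hl; rewrite -(cvg_lim _ h)//.
by apply: limr_le; [exact: cvgP h | exact: nearW].
Qed.

(** Absolute convergence. The last clause is [|X + iY| <= T], expressed by real linear functionals
    of norm at most 1. *)
Lemma psum_abs x T : (forall N, \sum_(0 <= n < N) `|x n| <= T) ->
  exists X Y, psum x X Y /\
    forall u v, u ^+ 2 + v ^+ 2 <= 1 -> u * X + v * Y <= T.
Proof.
move=> xT.
have cx : cvgn (series (fun n => `|x n|)).
  apply: nondecreasing_is_cvgn.
    by apply/nondecreasing_seqP => N; rewrite /series/= big_nat_recr//= lerDl.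
  by exists T => _ [N _ <-]; exact: xT.
have cl u v : u ^+ 2 + v ^+ 2 <= 1 ->
    cvgn (series (fun n => x n * (u * p n + v * q n) : R^o)).
  move=> uv; apply: normed_cvg.
  apply: (series_le_cvg _ _ _ cx) => n //=.
  by rewrite normrM ler_piMr// powpair_lin.
have /cvg_ex[/= X hX] := cl 1 0 ltac:(lra).
have /cvg_ex[/= Y hY] := cl 0 1 ltac:(lra).
have XY : psum x X Y.
  split.
    rewrite (_ : (fun n => x n * p n) = (fun n => x n * (1 * p n + 0 * q n)))//.
    by apply/funext => n; ring.
  rewrite (_ : (fun n => x n * q n) = (fun n => x n * (0 * p n + 1 * q n)))//.
  by apply/funext => n; ring.
exists X, Y; split => // u v uv; apply: (psum_le _ _ _ _ _ _ XY) => N.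
apply: le_trans (xT N); apply: ler_sum => n _.
by rewrite (le_trans (ler_norm _))// normrM ler_piMr// powpair_lin.
Qed.

(** All coefficients of [dif c] after the first are at most 0, and [Re xi^n <= 1]; so the real part
    of a partial sum is at least its value at [xi = 1], which telescopes to the last [c N]. *)
Lemma psum_nonincr c : (forall n, c n.+1 <= c n) -> (forall n, 0 <= c n) ->
  exists X Y, psum (dif c) X Y /\ 0 <= X.
Proof.
move=> cd c0.
have [X [Y [hXY _]]] := psum_abs _ _ (fun N => sum_abs_dif c N cd c0).
exists X, Y; split => //.
suff : -1 * X + 0 * Y <= 0 by lra.
apply: (psum_le _ _ _ _ _ _ hXY) => -[|N]; first by rewrite big_nil.
suff : \sum_(0 <= n < N.+1) dif c n * (-1 * p n + 0 * q n) <= - c N.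
  by move/le_trans; apply; rewrite oppr_le0.
elim: N => [|N IH]; first by rewrite big_nat1 /dif /p /q /=; lra.
rewrite big_nat_recr//=.
have : `|1 * p N.+1 + 0 * q N.+1| <= 1 by apply: powpair_lin; lra.
rewrite mul1r mul0r addr0 ler_norml => /andP[_ p1].
have := cd N; rewrite {2}/dif; nra.
Qed.

(* It suffices to compare with the value at [|xi|], since the second differences
   of [c] are nonnegative and [Re xi^n <= |xi|^n]. *)
Lemma convex_defect c M : (forall n, c n.+1 <= c n) -> (forall n, 0 <= c n) ->
  (forall n, c n.+1 - c n.+2 <= c n - c n.+1) ->
  (1 - 2 * a + (a ^+ 2 + b ^+ 2)) * c 0%N / 2 <=
  \sum_(0 <= n < M.+1) dif c n * ((1 - a) * p n + (- b) * q n).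
Proof.
move=> cd c0 cc; set r2 := a ^+ 2 + b ^+ 2.
pose d n := c n - c n.+1.
have d0 n : 0 <= d n by rewrite subr_ge0.
have r20 : 0 <= r2 by rewrite addr_ge0 ?sqr_ge0.
pose r := Num.sqrt r2.
have r0 : 0 <= r by exact: sqrtr_ge0.
have rr : r ^+ 2 = r2 by rewrite sqr_sqrtr.
have r1 : r <= 1 by rewrite -(@expr_le1 _ 2%N)// rr.
have pr n : p n <= r ^+ n.
  apply: le_trans (ler_norm _) _.
  rewrite -(@ler_pXn2r _ 2%N) ?nnegrE ?exprn_ge0// real_normK ?num_real//.
  by rewrite -exprM mulnC exprM rr -powpair_norm lerDl sqr_ge0.
pose w n := r ^+ n - p n.
have w0 n : 0 <= w n by rewrite subr_ge0.
(* Summation by parts with [w 0 = 0]; the left side is the boundary term that lets the induction go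
   through, using that [d] decreases and [r2 <= 1]. *)
have key N : r2 * (d N * w N) <= \sum_(0 <= n < N) d n * (w n.+1 - r2 * w n).
  elim: N => [|N IH].
    by rewrite big_nil /w /p /= expr0 subrr !mulr0.
  rewrite big_nat_recr//=.
  have h1 : d N.+1 * w N.+1 <= d N * w N.+1 by apply: ler_wpM2r => //; exact: cc.
  have h2 : r2 * (d N.+1 * w N.+1) <= d N.+1 * w N.+1.
    by rewrite ler_piMl// mulr_ge0.
  by lra.
(* Each power [r^n] is bounded by 1, after which the sum of [d] telescopes. *)
have dr N : \sum_(0 <= n < N) d n * (r ^+ n.+1 - r2 * r ^+ n) <=
    (1 - r) * r * (c 0%N - c N).
  elim: N => [|N IH]; first by rewrite big_nil subrr mulr0.
  rewrite big_nat_recr//= -rr.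
  have -> : r ^+ N.+1 - r ^+ 2 * r ^+ N = r ^+ N * ((1 - r) * r).
    by rewrite exprS; ring.
  have : d N * (r ^+ N * ((1 - r) * r)) <= d N * ((1 - r) * r).
    apply: ler_wpM2l => //; apply: ler_piMl; last exact: exprn_ile1.
    by rewrite mulr_ge0// subr_ge0.
  by rewrite rr; move: IH; rewrite /d; lra.
(* For positive indices, [conj xi * xi^(n+1) = |xi|^2 xi^n] turns the real part of
   [(1 - conj xi) xi^(n+1)] into [p (n+1) - r2 * p n]. *)
have -> : \sum_(0 <= n < M.+1) dif c n * ((1 - a) * p n + - b * q n) =
    (1 - a) * c 0%N - \sum_(0 <= n < M) d n * (p n.+1 - r2 * p n).
  elim: M => [|M IH].
    by rewrite big_nat1 big_nil /dif /p /q /=; ring.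
  rewrite big_nat_recr//= IH big_nat_recr//=.
  rewrite /dif /d /r2 !powpair_re !powpair_im; ring.
have sE : \sum_(0 <= n < M) d n * (w n.+1 - r2 * w n) =
    \sum_(0 <= n < M) d n * (r ^+ n.+1 - r2 * r ^+ n) -
    \sum_(0 <= n < M) d n * (p n.+1 - r2 * p n).
  by rewrite -sumrB; apply: eq_bigr => n _; rewrite /w; ring.
have k1 : 0 <= \sum_(0 <= n < M) d n * (w n.+1 - r2 * w n).
  by apply: le_trans (key M); rewrite !mulr_ge0.
have k2 : (1 - r) * r * (c 0%N - c M) <= (1 - r) * r * c 0%N.
  by rewrite ler_wpM2l ?gerBl// mulr_ge0// subr_ge0.
have k3 := dr M.
(* Half of this square is exactly the slack between [(1 - a) - (1 - r) r] and [(1 - 2 a + r2) / 2],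
   times [c 0]. *)
have k4 : 0 <= (1 - r) ^+ 2 * c 0%N by rewrite mulr_ge0 ?sqr_ge0.
have k5 : r ^+ 2 * c 0%N = r2 * c 0%N by rewrite rr.
by move: k1; rewrite sE; lra.
Qed.

(** Since [X + iY] is [(1 - xi) B(xi)], dividing the inequality by [|1 - xi|^2] gives
    [Re B >= c 0 / 2]. *)
Lemma psum_convex c : (forall n, c n.+1 <= c n) -> (forall n, 0 <= c n) ->
  (forall n, c n.+1 - c n.+2 <= c n - c n.+1) ->
  exists X Y, psum (dif c) X Y /\
    ((1 - a) ^+ 2 + b ^+ 2) * c 0%N / 2 <= (1 - a) * X - b * Y.
Proof.
move=> cd c0 cc.
have [X [Y [hXY _]]] := psum_abs _ _ (fun N => sum_abs_dif c N cd c0).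
exists X, Y; split => //.
have /(@psum_lin _ _ _ (1 - a) (- b)) h := hXY; rewrite -mulNr -(cvg_lim _ h)//.
apply: limr_ge; first exact: cvgP h.
(* The empty partial sum is skipped, since the lower bound needs the term of index 0. *)
exists 1%N => // -[//|N] _; have := convex_defect c N cd c0 cc.
by apply: le_trans; rewrite le_eqVlt; apply/orP; left; apply/eqP; ring.
Qed.

(** This is [|1 - xi| <= 2], in the form of a functional to which [psum_abs] applies. *)
Lemma disk_dist1 : (- (1 - a) / 2) ^+ 2 + (- b / 2) ^+ 2 <= 1.
Proof.
have b2 : 0 <= b ^+ 2 by exact: sqr_ge0.
have a2 : a ^+ 2 <= 1 by have := ab1; lra.
have /andP[a1 _] : -1 <= a <= 1.
  by rewrite -ler_norml -(@expr_le1 _ 2%N)// real_normK ?num_real.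
by have := ab1; lra.
Qed.

(* With [xi = a + ib], the product [(1 - conj xi) omega(xi)] equals
   [|1 - xi|^2 phi(xi)], so [(1 - a) X - b Y > 0] says [Re phi(xi) > 0]. *)
Lemma psum_neq0 (c e f g : nat -> R) (f0 T : R) :
  (a, b) != (1, 0) ->
  (forall n, c n.+1 <= c n) -> (forall n, 0 <= c n) ->
  (forall n, c n.+1 - c n.+2 <= c n - c n.+1) ->
  (forall n, e n.+1 <= e n) -> (forall n, 0 <= e n) ->
  (forall n, f n = (if n is 0%N then f0 else 0) + g n) ->
  (forall N, \sum_(0 <= n < N) `|dif g n| <= T) ->
  0 <= f0 -> 0 <= T -> f0 / 2 + 2 * T < c 0%N / 2 ->
  exists X Y, psum (fun n => dif c n + dif (dif e) n + dif (dif (dif f)) n) X Y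
    /\ (X, Y) != (0, 0).
Proof.
move=> ab0 cd c0 cc ed e0 fE gT f00 T0 fT.
have [B1 [B2 [hB Bge]]] := psum_convex c cd c0 cc.
have [E1 [E2 [hE Ege]]] := psum_nonincr e ed e0.
have [G1 [G2 [hG Gle]]] := psum_abs _ _ gT.
have h1 : psum (fun n => if n is 0%N then f0 else 0) f0 0.
  split; rewrite -cvg_shiftS /series/=.
    rewrite (_ : (fun n => _) = cst f0); first exact: cvg_cst.
    apply/funext => N /=; elim: N => [|N IH].
      by rewrite big_nat1 /p /= mulr1.
    by rewrite big_nat_recr//= IH mul0r addr0.
  rewrite (_ : (fun n => _) = cst 0); first exact: cvg_cst.
  apply/funext => N /=; elim: N => [|N IH].
    by rewrite big_nat1 /q /= mulr0.
  by rewrite big_nat_recr//= IH mul0r addr0.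
have hF := psumD _ _ _ _ _ _ (psum_dif _ _ _ h1) hG.
have dF : (fun n => dif (fun n => if n is 0%N then f0 else 0) n + dif g n) = dif f.
  by apply/funext => -[|n]; rewrite /dif !fE /=; ring.
rewrite dF in hF.
have hL := psumD _ _ _ _ _ _ (psumD _ _ _ _ _ _ hB (psum_dif _ _ _ hE))
  (psum_dif _ _ _ (psum_dif _ _ _ hF)).
set X := (X in psum _ X _) in hL; set Y := (X in psum _ _ X) in hL.
exists X, Y; split => //.
(* The right side is [Re ((1 - xi) G)], and [|G| <= T]. *)
have Gge : - (2 * T) <= (1 - a) * G1 + b * G2.
  have := Gle (- (1 - a) / 2) (- b / 2).
  have uv : (- (1 - a) / 2) ^+ 2 + (- b / 2) ^+ 2 <= 1.
    exact: disk_dist1.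
  by move=> /(_ uv); lra.
have Dgt0 : 0 < (1 - a) ^+ 2 + b ^+ 2.
  rewrite lt_neqAle addr_ge0 ?sqr_ge0// andbT eq_sym.
  apply: contra ab0; rewrite paddr_eq0 ?sqr_ge0// !sqrf_eq0 subr_eq0.
  by move=> /andP[/eqP <- /eqP ->].
(* [Re (1 - xi)^2 >= 2 a^2 - 2 a = 2 (a - 1/2)^2 - 1/2], because [b^2 <= 1 - a^2]. *)
have sqge : - (1 / 2) <= (1 - a) ^+ 2 - b ^+ 2 by have := ab1; have := sqr_ge0 (a - 1/2); lra.
have fge : - (f0 / 2) <= f0 * ((1 - a) ^+ 2 - b ^+ 2).
  by have := ler_wpM2l f00 sqge; lra.
have XYgt0 : 0 < (1 - a) * X - b * Y.
  have -> : (1 - a) * X - b * Y = ((1 - a) * B1 - b * B2) +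
     ((1 - a) ^+ 2 + b ^+ 2) *
       (E1 + f0 * ((1 - a) ^+ 2 - b ^+ 2) + ((1 - a) * G1 + b * G2)).
    by rewrite /X /Y; ring.
  set D := (1 - a) ^+ 2 + b ^+ 2 in Bge Dgt0 *.
  have : 0 < D * (c 0%N / 2 +
     (E1 + f0 * ((1 - a) ^+ 2 - b ^+ 2) + ((1 - a) * G1 + b * G2))).
    by apply: mulr_gt0 => //; lra.
  by lra.
by apply: contraTneq XYgt0 => -[-> ->]; rewrite !mulr0 subrr ltxx.
Qed.

End PowerSums.

(** * Moments on the unit interval *)

Section UnitInterval.
Variable R : realType.
Notation mu := (@lebesgue_measure R).
Implicit Types (f g : R -> R) (p : {poly R}).

(** By uniqueness of the measure with given values on half-open intervals; a reflection moves the
    closed end but keeps the length. *)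
Lemma lebesgue_measure_reflect (c : R) (A : set R) : measurable A ->
  mu A = pushforward mu (fun x : R => c - x) A.
Proof.
have mphi : measurable_fun [set: measurableTypeR R]
    (fun x : R => c - x : measurableTypeR R).
  by apply: measurable_funB.
move=> mA; have -> // := @lebesgue_measure_unique R
  (measure_function_pushforward__canonical__measure_function_Measure mu mphi).
move=> _ [[x y] /= _ <-]; rewrite /pushforward /=.
have -> : (fun x : R => c - x) @^-1` `]x, y] = `[c - y, c - x[.
  by apply/seteqP; split => z /=; rewrite !in_itv/=; lra.
rewrite !lebesgue_measure_itv/= !lte_fin ltrD2l ltrN2.
by case: ifPn => // _; rewrite -!EFinB; congr EFin; ring.
Qed.

(** Used with [c] the right end of a cell: [t] becomes the distance to that end, so every cell
    integral lives on the same interval. Endpoints are dropped as null sets. *)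
Lemma Rintegral_reflect (c : R) f : measurable_fun [set: R] f ->
  mu.-integrable `]0, 1[ (EFin \o (fun t => f (c - t))) ->
  Rintegral mu `[c - 1, c] f = Rintegral mu `]0, 1[ (fun t => f (c - t)).
Proof.
move=> mf fi; rewrite /Rintegral.
have mphi : measurable_fun [set: measurableTypeR R]
    (fun x : R => c - x : measurableTypeR R).
  by apply: measurable_funB.
have mEf : measurable_fun [set: R] (EFin \o f) by exact/measurable_EFinP.
rewrite -integral_itv_bndo_bndc; last exact: measurable_funTS.
rewrite -integral_itv_obnd_cbnd; last exact: measurable_funTS.
congr fine.
pose D : set R := `]c - 1, c[.
pose phi (x : R) : measurableTypeR R := c - x.
have E : phi @^-1` D = `]0, 1[.
  by apply/seteqP; split => z; rewrite /D /phi /= !in_itv/=; lra.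
transitivity (\int[pushforward mu phi]_(x in D)
    (EFin \o f) x)%E.
  by apply: eq_measure_integral => A mA _; exact: lebesgue_measure_reflect.
transitivity (\int[mu]_(x in phi @^-1` D) ((EFin \o f) \o phi) x)%E; last by rewrite E.
by apply: (@integral_pushforward _ _ (measurableTypeR R) (measurableTypeR R) R
  phi mphi mu D _ mEf) => //; rewrite ?E//; exact: measurable_itv.
Qed.

Lemma poly_bounded p : exists2 M : R, 0 <= M & forall t : R, 0 < t < 1 -> `|p.[t]| <= M.
Proof.
exists (\sum_(i < size p) `|p`_i|); first exact: sumr_ge0.
move=> t /andP[t0 t1]; rewrite horner_coef.
rewrite (le_trans (ler_norm_sum _ _ _))//; apply: ler_sum => i _.
rewrite normrM ler_piMr// normrX exprn_ile1// ger0_norm ?ltW//.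
Qed.

Lemma integrableMpoly g p : mu.-integrable `]0, 1[ (EFin \o g) ->
  mu.-integrable `]0, 1[ (EFin \o (fun t => g t * p.[t])).
Proof.
move=> gi; have [M M0 pM] := poly_bounded p.
have mp : measurable_fun (`]0, 1[ : set R) (horner p).
  by apply: measurable_funTS; apply: continuous_measurable_fun; exact: continuous_horner.
have mg : measurable_fun (`]0, 1[ : set R) g.
  by apply/measurable_EFinP; exact: measurable_int gi.
apply: (@le_integrable _ _ _ mu _ _ _ (fun t => M%:E * (EFin \o g) t)%E) => //.
- by apply/measurable_EFinP; exact: measurable_funM.
- move=> t t01 /=; rewrite lee_fin !normrM mulrC (ger0_norm M0).
  by rewrite ler_wpM2r// pM//; move: t01; rewrite /= in_itv.
- exact: integrableZl.
Qed.

Definition moment g p : R := Rintegral mu `]0, 1[ (fun t => g t * p.[t]).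

Lemma momentD g p q : mu.-integrable `]0, 1[ (EFin \o g) ->
  moment g (p + q) = moment g p + moment g q.
Proof.
move=> gi; rewrite /moment -RintegralD//; try exact: integrableMpoly.
by apply: eq_Rintegral => t _; rewrite hornerD mulrDr.
Qed.

Lemma momentZ g k p : mu.-integrable `]0, 1[ (EFin \o g) ->
  moment g (k *: p) = k * moment g p.
Proof.
move=> gi; rewrite /moment -RintegralZl//; try exact: integrableMpoly.
by apply: eq_Rintegral => t _; rewrite hornerZ mulrCA.
Qed.

Lemma momentB g g' p : mu.-integrable `]0, 1[ (EFin \o g) ->
  mu.-integrable `]0, 1[ (EFin \o g') ->
  moment (fun t => g t - g' t) p = moment g p - moment g' p.
Proof.
move=> gi gi'; rewrite /moment -RintegralB//; try exact: integrableMpoly.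
by apply: eq_Rintegral => t _; rewrite mulrBl.
Qed.

Lemma moment_le g g' p p' : mu.-integrable `]0, 1[ (EFin \o g) ->
  mu.-integrable `]0, 1[ (EFin \o g') ->
  (forall t, 0 < t < 1 -> g t * p.[t] <= g' t * p'.[t]) ->
  moment g p <= moment g' p'.
Proof.
move=> gi gi' h; apply: le_Rintegral; [by []|exact: integrableMpoly|exact: integrableMpoly|].
by move=> t /=; rewrite in_itv/=; exact: h.
Qed.

Lemma integrable_cst01 (k : R) : mu.-integrable `]0, 1[ (EFin \o (fun=> k)).
Proof.
apply: measurable_bounded_integrable => //.
  by rewrite /= lebesgue_measure_itv/= lte_fin ltr01 oppr0 adde0 ltry.
by exists `|k|; split => [|M kM t _ /=]; [exact: num_real|exact: ltW].
Qed.

Lemma integrable_poly01 p : mu.-integrable `]0, 1[ (EFin \o horner p).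
Proof.
have := integrableMpoly (fun=> 1) p (integrable_cst01 1).
by rewrite (_ : (fun t => 1 * p.[t]) = horner p)//; apply/funext => t; rewrite mul1r.
Qed.

Lemma moment_cst_Xn (k : R) n : moment (fun=> k) 'X^n = k / n.+1%:R.
Proof.
rewrite /moment RintegralZl//; last first.
  exact: integrable_poly01.
(* The known integral is that of [(1 - x)^n]; reflection with [c = 1] turns it into the one of
   [t^n]. *)
congr (_ * _); rewrite -Rintegral_onemXn.
have mo : measurable_fun [set: R] (fun x : R => unstable.onem x ^+ n).
  by apply: continuous_measurable_fun => x; exact: continuous_onemXn.
have := @Rintegral_reflect 1 (fun x => unstable.onem x ^+ n) mo; rewrite subrr => ->.
  by apply: eq_Rintegral => t _; rewrite hornerXn /unstable.onem opprB addrC subrK.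
rewrite (_ : (fun t => _) = horner 'X^n); first exact: integrable_poly01.
by apply/funext => t; rewrite hornerXn /unstable.onem opprB addrC subrK.
Qed.

Definition quad (c0 c1 c2 : R) : {poly R} := c0 *: 'X^0 + c1 *: 'X^1 + c2 *: 'X^2.

Lemma horner_quad c0 c1 c2 (t : R) :
  (quad c0 c1 c2).[t] = c0 + c1 * t + c2 * t ^+ 2.
Proof. by rewrite !hornerD !hornerZ !hornerXn expr0 expr1 mulr1. Qed.

Lemma moment_quad g c0 c1 c2 : mu.-integrable `]0, 1[ (EFin \o g) ->
  moment g (quad c0 c1 c2) =
  c0 * moment g 'X^0 + c1 * moment g 'X^1 + c2 * moment g 'X^2.
Proof. by move=> gi; rewrite !momentD// !momentZ. Qed.

Lemma moment1_quad (c0 c1 c2 : R) :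
  moment (fun=> 1) (quad c0 c1 c2) = c0 + c1 / 2 + c2 / 3.
Proof.
rewrite moment_quad; last exact: integrable_cst01.
by rewrite !moment_cst_Xn; lra.
Qed.

(* Chebyshev's argument: [g - g t0] and [p] have the same sign. *)
Lemma moment_ge0 g p (t0 : R) : mu.-integrable `]0, 1[ (EFin \o g) ->
  (forall s t, 0 < s -> s <= t -> t < 1 -> g t <= g s) -> 0 < t0 < 1 ->
  (forall t, 0 < t <= t0 -> 0 <= p.[t]) ->
  (forall t, t0 <= t < 1 -> p.[t] <= 0) ->
  moment (fun=> 1) p = 0 -> 0 <= moment g p.
Proof.
move=> gi gd /andP[t00 t01] pp pn p0.
have ci := integrable_cst01.
have : 0 <= moment (fun t => g t - g t0) p.
  apply: Rintegral_ge0 => t /=; rewrite in_itv/= => /andP[t1 t2].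
  have [tt0|/ltW t0t] := leP t t0.
    by rewrite mulr_ge0 ?pp ?t1// subr_ge0 gd.
  by rewrite mulr_le0 ?pn ?t0t// subr_le0 gd.
rewrite momentB//.
suff -> : moment (fun=> g t0) p = g t0 * moment (fun=> 1) p.
  by rewrite p0 mulr0 subr0.
rewrite /moment -RintegralZl//; last exact: integrableMpoly.
by apply: eq_Rintegral => t _; rewrite mul1r.
Qed.

End UnitInterval.

(** * The kernel and the Gamma function *)

Section Kernel.
Variables (R : realType) (alpha : R).
Hypothesis alpha01 : 0 < alpha < 1.
Notation mu := (@lebesgue_measure R).

Definition ker (x : R) : R := x `^ (- alpha).

Lemma ker_gt0 x : 0 < x -> 0 < ker x.
Proof. exact: powR_gt0. Qed.

Lemma ker1 : ker 1 = 1.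
Proof. by rewrite /ker powR1. Qed.

Lemma ker_nonincr x y : 0 < x -> x <= y -> ker y <= ker x.
Proof.
move=> x0 xy; have y0 : 0 < y := lt_le_trans x0 xy.
have /andP[/ltW a0 _] := alpha01.
rewrite /ker !powRN lef_pV2 ?posrE ?powR_gt0//.
by apply: ge0_ler_powR => //; rewrite nnegrE ltW.
Qed.

(** Homogeneity gives [ker z - ker (z + 1) = ker z * (1 - ker (1 + 1/z))], a product of two
    nonnegative factors that both decrease in [z]. *)
Lemma ker_dif_nonincr x y : 0 < x -> x <= y ->
  ker y - ker (y + 1) <= ker x - ker (x + 1).
Proof.
move=> x0 xy; have y0 : 0 < y := lt_le_trans x0 xy.
have kE z : 0 < z -> ker z - ker (z + 1) = ker z * (1 - ker (1 + z^-1)).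
  move=> z0; have -> : z + 1 = z * (1 + z^-1) by rewrite mulrDr mulr1 divff ?gt_eqF.
  by rewrite /ker powRM ?ltW ?addr_gt0 ?invr_gt0// mulrBr mulr1.
have xV : 0 < x^-1 by rewrite invr_gt0.
have yV : 0 < y^-1 by rewrite invr_gt0.
rewrite !kE//; apply: ler_pM.
- exact/ltW/ker_gt0.
- by rewrite subr_ge0 -[leRHS]ker1 ker_nonincr// lerDl ltW.
- exact: ker_nonincr.
- rewrite lerD2l lerN2 ker_nonincr// ?addr_gt0//.
  by rewrite lerD2l lef_pV2.
Qed.

Lemma measurable_ker : measurable_fun [set: R] ker.
Proof. exact: measurable_powR. Qed.

(** Monotone convergence over [[1/(n+2), 1]], where the antiderivative [x^(1 - alpha) / (1 - alpha)]
    bounds the integral by [1 / (1 - alpha)] uniformly. Starting at [n + 2] keeps each interval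
    nondegenerate. *)
Lemma integrable_ker01 : mu.-integrable `]0, 1] (EFin \o ker).
Proof.
have /andP[a0 a1] := alpha01.
have mk D : measurable_fun D (EFin \o ker).
  by apply/measurable_EFinP; apply: measurable_funTS; exact: measurable_ker.
apply/integrableP; split; first exact: mk.
pose F (n : nat) : set R := `[n.+2%:R^-1, 1].
have FE : `]0, 1] = \bigcup_n F n.
  apply/seteqP; split => [x|x [n _]]; rewrite /F /= !in_itv/=.
    move=> /andP[x0 x1]; exists (Num.truncn x^-1) => //=; rewrite in_itv/= x1 andbT.
    rewrite invf_ple ?posrE// ltW//.
    by apply: lt_trans (truncnS_gt _) _; rewrite ltr_nat.
  by move=> /andP[nx ->]; rewrite andbT (lt_le_trans _ nx)// invr_gt0.
have -> : (fun x : R => `|(EFin \o ker) x|%E) = EFin \o ker.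
  by apply/funext => x /=; rewrite ger0_norm// powR_ge0.
have Fnd : nondecreasing_seq F.
  move=> m n mn; apply/subsetPset => x; rewrite /F /= !in_itv/= => /andP[mx ->].
  by rewrite andbT (le_trans _ mx)// lef_pV2 ?posrE// ler_nat !ltnS.
have cvgF : (\int[mu]_(x in F n) (EFin \o ker) x)%E @[n --> \oo] -->
    (\int[mu]_(x in \bigcup_n F n) (EFin \o ker) x)%E.
  apply: ge0_nondecreasing_set_cvg_integral => //.
  - by move=> n; exact: measurable_itv.
  - by move=> n; exact: mk.
  - by move=> n x _; rewrite lee_fin powR_ge0.
rewrite FE -(cvg_lim _ cvgF)//.
apply: (@le_lt_trans _ _ ((1 - alpha)^-1)%:E); last exact: ltry.
apply: lime_le; first exact: cvgP cvgF.
apply: nearW => n; rewrite /F.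
have n0 : 0 < n.+2%:R^-1 :> R by rewrite invr_gt0.
have nz : 1 - alpha != 0 by rewrite gt_eqF// subr_gt0.
pose P (x : R) := (1 - alpha)^-1 * x `^ (1 - alpha).
have dP (x : R) : 0 < x -> is_derive x 1 (P : R -> R^o) (ker x).
  move=> x0; have h := is_derive1_powR (1 - alpha) x0.
  have -> : ker x = (1 - alpha)^-1 *: ((1 - alpha) * x `^ (1 - alpha - 1)).
    rewrite /ker /GRing.scale/= mulrA mulVf// mul1r; congr (_ `^ _); ring.
  exact: is_deriveZ.
have cK (x : R) : 0 < x -> {for x, continuous ker}.
  move=> x0; apply: differentiable_continuous; apply/derivable1_diffP.
  by apply: derivable_powR; rewrite in_itv/= x0.
have cP (x : R) : 0 < x -> {for x, continuous P}.
  by move=> x0; apply: differentiable_continuous; apply/derivable1_diffP; have := dP x x0.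
rewrite (@continuous_FTC2 _ ker P)//.
- rewrite -EFinB lee_fin /P powR1 mulr1 gerBl.
  by rewrite mulr_ge0 ?powR_ge0// invr_ge0 ltW// subr_gt0.
- by rewrite invf_lt1 ?ltr1n.
- apply: continuous_in_subspaceT => x; rewrite inE/= in_itv/= => /andP[nx _].
  by apply: cK; exact: lt_le_trans nx.
- split.
  + move=> x; rewrite in_itv/= => /andP[nx _].
    by have [] := dP x (lt_trans n0 nx).
  + by apply: cvg_at_right_filter; exact: cP.
  + by apply: cvg_at_left_filter; exact: cP.
- move=> x; rewrite in_itv/= => /andP[nx _].
  by rewrite derive1E; have [] := dP x (lt_trans n0 nx).
Qed.

Lemma integrable_ker_shift (r : nat) :
  mu.-integrable `]0, 1[ (EFin \o (fun t => ker (r%:R + t))).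
Proof.
have i01 : mu.-integrable `]0, 1[ (EFin \o ker).
  apply: integrableS integrable_ker01 => //.
  by move=> x /=; rewrite !in_itv/= => /andP[-> /ltW].
apply: le_integrable i01 => //.
  apply/measurable_EFinP; apply: measurable_funTS.
  by apply: measurableT_comp; [exact: measurable_ker|exact: measurable_funD].
move=> t /=; rewrite in_itv/= => /andP[t0 _]; rewrite lee_fin.
by rewrite !ger0_norm ?powR_ge0// ker_nonincr// lerDr.
Qed.

(** On []0, 1]] the integrand is at least [exp (-1)], and the rest of the half-line contributes
    nonnegatively. *)
Lemma Gamma_neq0 : Gamma (1 - alpha) != 0.
Proof.
have /andP[a0 a1] := alpha01.
pose f (x : R) := ker x * expR (- x).
have fE : (fun x : R => x `^ (1 - alpha - 1) * expR (- x)) = f.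
  by apply/funext => x; rewrite /f /ker; congr (_ `^ _ * _); ring.
rewrite /Gamma fE.
have f0 x : 0 <= f x by rewrite mulr_ge0 ?powR_ge0 ?expR_ge0.
have mf : measurable_fun [set: R] f.
  apply: measurable_funM; first exact: measurable_ker.
  by apply: measurableT_comp => //; exact: measurable_funN.
have mEf D : measurable_fun D (EFin \o f).
  by apply/measurable_EFinP; apply: measurable_funTS.
have f1 : mu.-integrable `]0, 1] (EFin \o f).
  apply: le_integrable integrable_ker01 => //; first exact: mEf.
  move=> t /=; rewrite in_itv/= => /andP[t0 _]; rewrite lee_fin !ger0_norm ?powR_ge0//.
  by rewrite ler_piMr ?powR_ge0// -expR0 ler_expR oppr_le0 ltW.
(* Finiteness matters: [Rintegral] would send an infinite integral to 0. The exponential density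
   dominates here. *)
have f2 : mu.-integrable `]1, +oo[ (EFin \o f).
  have : mu.-integrable `]1, +oo[ (EFin \o exponential_pdf 1).
    by apply: integrableS (integrable_exponential_pdf _) => //; exact: ltr01.
  apply: le_integrable => //; first exact: mEf.
  move=> t /=; rewrite in_itv/= andbT => t1; have t0 : 0 <= t by exact: ltW (lt_trans _ t1).
  rewrite lee_fin !ger0_norm ?exponential_pdf_ge0// exponential_pdfE//.
  rewrite mul1r mulN1r ler_piMl ?expR_ge0// -[leRHS]ker1.
  by apply: ker_nonincr => //; exact: ltW.
have UE : `]0, 1] `|` `]1, +oo[ = `]0, +oo[ :> set R.
  apply/seteqP; split => x /=; rewrite !in_itv/= !andbT.
    by move=> [/andP[]//|]; exact: lt_trans.
  by move=> x0; have [x1|x1] := leP x 1; [left; rewrite x0|right].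
have -> : Rintegral mu `]0, +oo[ f = Rintegral mu `]0, 1] f + Rintegral mu `]1, +oo[ f.
  rewrite /Rintegral -UE ge0_integral_setU//.
  - by rewrite fineD//; exact: integrable_fin_num.
  - exact: mEf.
  - by move=> x _; rewrite lee_fin.
  - apply/disj_setPS => x [/=]; rewrite !in_itv/= andbT => /andP[_ x1].
    by rewrite ltNge x1.
rewrite gt_eqF//; apply: ltr_wpDr; first by apply: Rintegral_ge0 => x _; exact: f0.
apply: (@lt_le_trans _ _ (expR (-1))); first exact: expR_gt0.
have := @le_Rintegral _ _ _ mu `]0, 1] (fun=> expR (-1)) f.
rewrite Rintegral_cst//= lebesgue_measure_itv/= lte_fin ltr01 oppr0 adde0/= mulr1.
apply => //.
  apply: measurable_bounded_integrable => //.
    by rewrite /= lebesgue_measure_itv/= lte_fin ltr01 oppr0 adde0 ltry.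
  by exists `|expR (-1)|; split => [|M kM t _ /=]; [exact: num_real|exact: ltW].
move=> x /=; rewrite in_itv/= => /andP[x0 x1].
rewrite -[leLHS]mul1r ler_pM ?expR_ge0//.
  by rewrite -[leLHS]ker1 ker_nonincr.
by rewrite ler_expR lerN2.
Qed.

End Kernel.

(** * Moments of the kernel *)

Section KernelMoments.
Variables (R : realType) (alpha : R).
Hypothesis alpha01 : 0 < alpha < 1.
Notation mu := (@lebesgue_measure R).
Notation ker := (ker R alpha).

Definition kmom (r : nat) (p : {poly R}) : R := moment R (fun t => ker (r%:R + t)) p.

Let ki := integrable_ker_shift R alpha alpha01.

Lemma kmomZ r c p : kmom r (c *: p) = c * kmom r p.
Proof. exact: momentZ. Qed.

Lemma kmom_quad r c0 c1 c2 : kmom r (quad R c0 c1 c2) =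
  c0 * kmom r 'X^0 + c1 * kmom r 'X^1 + c2 * kmom r 'X^2.
Proof. exact: moment_quad. Qed.

Lemma integrable_ker_dif r : mu.-integrable `]0, 1[
  (EFin \o (fun t => ker (r%:R + t) - ker (r.+1%:R + t))).
Proof.
have := @integrableB _ _ _ mu `]0, 1[ (measurable_itv _) _ _ (ki r) (ki r.+1).
by apply: eq_integrable => // t _ /=; rewrite EFinB.
Qed.

Lemma ker_dif_shift (r : nat) (s t : R) : 0 < s -> s <= t ->
  ker (r%:R + t) - ker (r.+1%:R + t) <= ker (r%:R + s) - ker (r.+1%:R + s).
Proof.
move=> s0 st.
have E u : r.+1%:R + u = (r%:R + u) + 1 :> R by rewrite -natr1 addrAC.
by rewrite !E ker_dif_nonincr// ?lerD2l// ltr_wpDl.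
Qed.

(** The difference of two consecutive kernels is again nonincreasing in [t], so the sign argument of
    [moment_ge0] applies to it. *)
Lemma kmom_nonincr r p (t0 : R) : 0 < t0 < 1 ->
  (forall t, 0 < t <= t0 -> 0 <= p.[t]) ->
  (forall t, t0 <= t < 1 -> p.[t] <= 0) ->
  moment R (fun=> 1) p = 0 -> kmom r.+1 p <= kmom r p.
Proof.
move=> t01 pp pn p0; rewrite -subr_ge0 -momentB//.
apply: (@moment_ge0 R _ p t0) => //; first exact: integrable_ker_dif.
by move=> s t s0 st _; exact: ker_dif_shift.
Qed.

Definition kb r := kmom r 'X^0.
(** This polynomial and the next two have mean zero on the unit interval and change sign once, from
    plus to minus; hence their moments decrease in [r]. *)
Definition ke r := kmom r (quad R (1/2) (-1) 0).
Definition kh r := kmom r (quad R (1/6) 0 (-(1/2))).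
Definition kf r := kmom r (quad R (1/3) (-1) (1/2)).

Lemma kfE r : kf r = ke r - kh r.
Proof. by rewrite /kf /ke /kh !kmom_quad; lra. Qed.

Lemma ker_shift_gt0 (r : nat) (t : R) : 0 < t -> 0 < ker (r%:R + t).
Proof. by move=> t0; rewrite ker_gt0// ltr_wpDl. Qed.

Lemma kb_ge0 r : 0 <= kb r.
Proof.
apply: Rintegral_ge0 => t /=; rewrite in_itv/= => /andP[t0 _].
by rewrite hornerXn expr0 mulr1 ltW// ker_shift_gt0.
Qed.

Lemma kb_nonincr r : kb r.+1 <= kb r.
Proof.
apply: moment_le => // t /andP[t0 _]; rewrite hornerXn expr0 !mulr1.
apply: ker_nonincr => //; first by rewrite ltr_wpDl.
by rewrite lerD2r ler_nat.
Qed.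

Lemma kb_convex r : kb r.+1 - kb r.+2 <= kb r - kb r.+1.
Proof.
rewrite -!momentB//; apply: moment_le; [exact: integrable_ker_dif..|].
move=> t /andP[t0 _]; rewrite hornerXn expr0 !mulr1.
have := @ker_dif_shift r t (1 + t) t0; rewrite lerDr ler01 => /(_ isT).
by rewrite !addrA !natr1.
Qed.

Lemma kb0_ge1 : 1 <= kb 0.
Proof.
have <- : moment R (fun=> 1) 'X^0 = 1 by rewrite moment_cst_Xn divr1.
apply: moment_le => //; first exact: integrable_cst01.
move=> t /andP[t0 t1]; rewrite hornerXn expr0 !mulr1 add0r.
by rewrite -[leLHS](ker1 R alpha) ker_nonincr// ltW.
Qed.

Lemma cvg_ker : (fun n : nat => ker n.+1%:R) @ \oo --> (0 : R).
Proof.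
have /andP[a0 a1] := alpha01.
apply/cvgrPdist_le => e e0; near=> n.
rewrite sub0r normrN ger0_norm ?powR_ge0// /ker powRN.
have n0 : 0 < n.+1%:R `^ alpha :> R by rewrite powR_gt0.
rewrite invf_ple ?posrE//.
have -> : e^-1 = (e^-1 `^ alpha^-1) `^ alpha.
  by rewrite -powRrM mulVf ?gt_eqF// powRr1// invr_ge0 ltW.
apply: ge0_ler_powR; rewrite ?nnegrE ?powR_ge0 ?(ltW a0)//.
apply: (@le_trans _ _ n%:R); last by rewrite ler_nat.
by near: n; exact: nbhs_infty_ger.
Unshelve. all: by end_near. Qed.

Lemma cvg_kb : kb @ \oo --> (0 : R).
Proof.
rewrite -cvg_shiftS /=.
apply: (@squeeze_cvgr _ _ _ _ (fun=> 0) (fun n : nat => ker n.+1%:R)).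
- apply: nearW => n; rewrite kb_ge0/=.
  have <- : moment R (fun=> ker n.+1%:R) 'X^0 = ker n.+1%:R.
    by rewrite moment_cst_Xn divr1.
  apply: moment_le => //; first exact: integrable_cst01.
  move=> t /andP[t0 t1]; rewrite hornerXn expr0 !mulr1.
  by apply: ker_nonincr => //; rewrite lerDl ltW.
- exact: cvg_cst.
- exact: cvg_ker.
Qed.

(** A polynomial bounded by [M] on the unit interval has moments between [- M * kb r] and
    [M * kb r]. *)
Lemma cvg_kmom p : (fun r => kmom r p) @ \oo --> (0 : R).
Proof.
have [M M0 pM] := poly_bounded R p.
have h (q : {poly R}) r : (forall t : R, 0 < t < 1 -> q.[t] <= M) -> kmom r q <= M * kb r.
  move=> qM; rewrite -kmomZ; apply: moment_le => // t t01.
  rewrite hornerZ hornerXn expr0 mulr1 ler_wpM2l ?qM//.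
  by case/andP: t01 => t0 _; rewrite ltW// ker_shift_gt0.
apply: (@squeeze_cvgr _ _ _ _ (fun r => - (M * kb r)) (fun r => M * kb r)).
- apply: nearW => r; rewrite h ?andbT; last first.
    by move=> t /pM; rewrite ler_norml => /andP[].
  rewrite lerNl -mulN1r -kmomZ h// => t /pM; rewrite hornerZ ler_norml; lra.
- rewrite -oppr0; apply: cvgN; rewrite -(mulr0 M); apply: cvgMr; exact: cvg_kb.
- by rewrite -(mulr0 M); apply: cvgMr; exact: cvg_kb.
Qed.

Let s3 : R := Num.sqrt (1/3).

Lemma sqrt13 : [/\ 0 < s3, s3 < 1 & s3 ^+ 2 = 1/3].
Proof.
have h : s3 ^+ 2 = 1/3 by rewrite sqr_sqrtr//; lra.
have s0 : 0 < s3 by rewrite sqrtr_gt0; lra.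
by split=> //; rewrite -(@expr_lt1 _ 2%N) ?h ?ltW//; lra.
Qed.

Lemma ke_nonincr r : ke r.+1 <= ke r.
Proof.
apply: (@kmom_nonincr r _ (1/2)); rewrite ?moment1_quad; try lra.
- by move=> t; rewrite horner_quad; lra.
- by move=> t; rewrite horner_quad; lra.
Qed.

Lemma kh_nonincr r : kh r.+1 <= kh r.
Proof.
have [s0 s1 s2] := sqrt13.
apply: (@kmom_nonincr r _ s3); rewrite ?moment1_quad ?s0 ?s1//; try lra.
- move=> t /andP[t0 ts]; rewrite horner_quad.
  by have := @ler_pM _ t s3 t s3 (ltW t0) (ltW t0) ts ts; lra.
- move=> t /andP[st t1]; rewrite horner_quad.
  by have := @ler_pM _ s3 t s3 t (ltW s0) (ltW s0) st st; lra.
Qed.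

Lemma kf_nonincr r : kf r.+1 <= kf r.
Proof.
have [s0 s1 s2] := sqrt13.
have h t : (quad R (1/3) (-1) (1/2)).[t] = ((1 - t) ^+ 2 - s3 ^+ 2) / 2.
  by rewrite horner_quad s2; lra.
apply: (@kmom_nonincr r _ (1 - s3)); rewrite ?moment1_quad; try lra.
- move=> t /andP[t0 ts]; rewrite h divr_ge0// subr_ge0.
  by rewrite ler_pXn2r ?nnegrE//; lra.
- move=> t /andP[t0 ts]; rewrite h ler_pdivrMr// mul0r subr_le0.
  by rewrite ler_pXn2r ?nnegrE//; lra.
Qed.

Lemma ke_ge0 r : 0 <= ke r.
Proof. exact: (nonincr_ge0 _ _ ke_nonincr (cvg_kmom _)). Qed.

Lemma kh_ge0 r : 0 <= kh r.
Proof. exact: (nonincr_ge0 _ _ kh_nonincr (cvg_kmom _)). Qed.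

Lemma kf_ge0 r : 0 <= kf r.
Proof. exact: (nonincr_ge0 _ _ kf_nonincr (cvg_kmom _)). Qed.

(** The comparison is relative to [kb 0] because the kernel is singular at 0 and [kb 0] is unbounded
    as [alpha] tends to 1. *)
Lemma kf0_le : kf 0 <= kb 0 / 3.
Proof.
rewrite mulrC -kmomZ; apply: moment_le => // t t01.
rewrite hornerZ hornerXn expr0 mulr1 ler_wpM2l//.
  by case/andP: t01 => t0 _; rewrite ltW// ker_shift_gt0.
rewrite horner_quad; case/andP: t01 => t0 t1.
have h : 0 <= t * (1 - t) by rewrite mulr_ge0 ?subr_ge0 ?ltW.
by lra.
Qed.

Lemma ker_shift1_itv (t : R) : 0 < t < 1 -> 1/2 <= ker (1 + t) <= 1.
Proof.
move=> /andP[t0 t1]; have /andP[a0 a1] := alpha01; apply/andP; split.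
  apply: (@le_trans _ _ (ker 2)); last by apply: ker_nonincr => //; lra.
  have -> : 1/2 = 2 `^ (-1) :> R by rewrite powR_inv1// mul1r.
  by rewrite ler_powR// ?ler1n// lerN2 ltW.
by rewrite -[leRHS](ker1 R alpha) ker_nonincr// lerDl ltW.
Qed.

(* AM-GM: [(K - 3/4) q <= ((K - 3/4)^2 + q^2) / 2] with [q = 1/2 - t]. *)
Lemma ke1_lt : ke 1 < 1/12.
Proof.
(* The majorant is [3/4 q + 1/32 + q^2 / 2], since [K] in [[1/2, 1]] gives [(K - 3/4)^2 <= 1/16];
   its mean is 7/96. *)
apply: (@le_lt_trans _ _ (moment R (fun=> 1)
    (quad R (3/8 + 1/32 + 1/8) (-(3/4) - 1/2) (1/2)))); last first.
  by rewrite moment1_quad; lra.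
apply: moment_le => //; first exact: integrable_cst01.
move=> t t01; rewrite !horner_quad.
have := ker_shift1_itv t t01; set K := ker _ => /andP[K1 K2].
have h1 : 0 <= (K - 1/2) * (1 - K) by rewrite mulr_ge0 ?subr_ge0.
have h2 := sqr_ge0 (K - 3/4 - (1/2 - t)).
by lra.
Qed.

(* AM-GM: [(K - 3/4) p <= 3/10 (K - 3/4)^2 + 5/6 p^2] with [p = (1 - 3 t^2)/6]. *)
Lemma kh1_lt : kh 1 < 1/24.
Proof.
(* The majorant [3/4 p + 3/160 + 5/6 p^2], again from [(K - 3/4)^2 <= 1/16]; its mean is
   [3/160 + 1/54]. *)
pose P : {poly R} := quad R (1/8 + 3/160 + 5/216) 0 (-(3/8) - 5/36) + (5/24) *: 'X^4.
apply: (@le_lt_trans _ _ (moment R (fun=> 1) P)); last first.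
  rewrite momentD ?momentZ; try exact: integrable_cst01.
  by rewrite moment1_quad moment_cst_Xn; lra.
apply: moment_le => //; first exact: integrable_cst01.
move=> t t01; rewrite [P.[t]]hornerD hornerZ hornerXn !horner_quad.
have := ker_shift1_itv t t01; set K := ker _ => /andP[K1 K2].
have h1 : 0 <= (K - 1/2) * (1 - K) by rewrite mulr_ge0 ?subr_ge0.
have h2 := sqr_ge0 (3/5 * (K - 3/4) - (1/6 - 1/2 * t ^+ 2)).
by lra.
Qed.

End KernelMoments.

(** * The quadrature weights *)

Section Weights.
Variables (R : realType) (alpha : R).
Hypothesis alpha01 : 0 < alpha < 1.
Notation mu := (@lebesgue_measure R).
Notation kmom := (kmom R alpha).

Lemma lagrange_shift (a : R) (y : nat -> R) m :
  Defs.lagrange (fun l => a + l%:R) y m =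
  Defs.lagrange (fun l => l%:R) y m \Po ('X - a%:P).
Proof.
rewrite /Defs.lagrange linear_sum; apply: eq_bigr => l _ /=.
rewrite linearZ/= rmorph_prod/=; congr (_ *: _); apply: eq_bigr => r _.
rewrite comp_polyZ comp_polyB comp_polyX comp_polyC polyCD.
congr (_ *: _); first by congr (_^-1); ring.
by rewrite opprD addrA.
Qed.

(* The variable of this polynomial is the distance to the right end of [I_j],
   which is [k + 1 - q] steps after the first interpolation node. *)
Definition dinterp (y : nat -> R) k q : {poly R} :=
  (Defs.lagrange (fun l => l%:R) y k)^`() \Po ((k.+1 - q)%:R%:P - 'X).

Lemma eq_dinterp y y' k q : (forall l, (l <= k)%N -> y l = y' l) ->
  dinterp y k q = dinterp y' k q.
Proof.
move=> yy'; congr (_^`() \Po _); apply: eq_bigr => l _.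
by rewrite yy'// -ltnS ltn_ord.
Qed.

Lemma dinterp0 k q : dinterp (fun=> 0) k q = 0.
Proof.
rewrite /dinterp /Defs.lagrange big1 ?deriv0 ?comp_poly0// => l _.
by rewrite scale0r.
Qed.

Lemma kmom0 r : kmom r 0 = 0.
Proof. by rewrite -(scale0r 'X^0) kmomZ// mul0r. Qed.

(** Substituting [xi = j - t] gives the kernel at [(n - j) + t]. The hypothesis [k < j + q] keeps
    the first node index [j + q - k - 1] free of truncation. *)
Lemma Rintegral_interp u k j q n : (k < j + q)%N -> (q <= k.+1)%N ->
    (0 < j <= n)%N ->
  Rintegral mu `[(j.-1)%:R * 1, j%:R * 1]
    (fun xi => (n%:R * 1 - xi) `^ (- alpha) * (interp 1 u k j q)^`().[xi]) =
  kmom (n - j) (dinterp (fun l => u (j + q - k.+1 + l)%N) k q).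
Proof.
move=> kjq qk /andP[j0 jn]; rewrite !mulr1.
have -> : j.-1%:R = j%:R - 1 :> R by rewrite -[in RHS](prednK j0) -natr1 addrK.
have E t : n%:R - (j%:R - t) = (n - j)%:R + t :> R by rewrite natrB//; ring.
have D t : (interp 1 u k j q)^`().[j%:R - t] =
    (dinterp (fun l => u (j + q - k.+1 + l)%N) k q).[t].
  rewrite /interp /dinterp.
  under [fun l => (_ + l)%:R * 1]eq_fun do rewrite mulr1 natrD.
  rewrite lagrange_shift deriv_comp derivB derivX derivC subr0 mulr1.
  rewrite !horner_comp; congr (_.[_]); rewrite !hornerE.
  by rewrite natrB// natrB// natrD; ring.
rewrite Rintegral_reflect.
- by apply: eq_Rintegral => t _ /=; rewrite D E.
- apply: measurable_funM.
    rewrite -[fun x => _]/(ker R alpha \o (fun x => n%:R - x)).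
    by apply: measurableT_comp; [exact: measurable_ker|exact: measurable_funB].
  by apply: continuous_measurable_fun; exact: continuous_horner.
- have := integrableMpoly R _ (dinterp (fun l => u (j + q - k.+1 + l)%N) k q)
    (integrable_ker_shift R alpha alpha01 (n - j)).
  by apply: eq_integrable => // t _ /=; rewrite D E.
Qed.

(** With [n = m + k] and data the unit vector at [k], the first sum runs over the interior cells,
    whose stencil starts at node [a], and the second over the last [i - 1] cells, which share the
    stencil starting at [m]. *)
Lemma weightE k i m : (1 <= i)%N -> (i <= k)%N ->
  weight alpha k i m = (Gamma (1 - alpha))^-1 *
   (\sum_(0 <= a < m.+1)
      kmom (i.-1 + m - a) (dinterp (fun l => (a + l == k)%:R) k i) +
    \sum_(0 <= r < i.-1)
      kmom r (dinterp (fun l => (m + l == k)%:R) k r.+1)).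
Proof.
move=> i1 ik; rewrite /weight /Defs.coefD powR1 mul1r /DCaputo; congr (_ * _).
set u := fun l : nat => (l == k)%:R : R.
pose T (j : nat) : R := Rintegral mu `[(j.-1)%:R * 1, j%:R * 1]
    (fun xi => ((m + k)%:R * 1 - xi) `^ (- alpha) *
       (piece 1 u k i (m + k) j)^`().[xi]).
rewrite -/(\sum_(1 <= j < (m + k).+1) T j).
rewrite (@big_cat_nat _ _ _ (k - i).+1)//=; last by lia.
(* The starting cells interpolate at nodes [0, ..., k - 1] only, so they do not see the value at
   [k]. *)
rewrite big1_seq ?add0r; last first.
  move=> j; rewrite mem_index_iota => /andP[_ /andP[j1 jk]]; rewrite /T.
  have -> : piece 1 u k i (m + k) j = interp 1 u k.-1 j (k - j).
    by rewrite /piece ifT//; lia.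
  rewrite Rintegral_interp; [|lia..].
  rewrite (@eq_dinterp _ (fun=> 0)) ?dinterp0 ?kmom0// => l lk.
  by rewrite /u; case: eqP => //; lia.
rewrite (@big_cat_nat _ _ _ (m + k - i).+2)//=; [|lia|lia].
congr (_ + _).
  have -> : \sum_((k - i).+1 <= j < (m + k - i).+2) T j =
      \sum_(0 + (k - i).+1 <= j < m.+1 + (k - i).+1) T j.
    by rewrite add0n; congr bigop; congr index_iota; lia.
  rewrite big_addn addnK; apply: eq_big_nat => a /andP[_ am]; rewrite /T.
  have -> : piece 1 u k i (m + k) (a + (k - i).+1) = interp 1 u k (a + (k - i).+1) i.
    by rewrite /piece ifF ?ifT//; lia.
  rewrite Rintegral_interp; [|lia..].
  rewrite (_ : (m + k - (a + (k - i).+1) = i.-1 + m - a)%N); last by lia.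
  congr kmom; apply: eq_dinterp => l lk; rewrite /u; congr ((_ == _)%:R); lia.
have -> : \sum_((m + k - i).+2 <= j < (m + k).+1) T j =
    \sum_(0 + (m + k - i).+2 <= j < i.-1 + (m + k - i).+2) T j.
  by rewrite add0n; congr bigop; congr index_iota; lia.
(* Reversal makes [r] count the cells backwards from the last one. *)
rewrite big_addn addnK big_nat_rev/=; apply: eq_big_nat => r /andP[_ ri]; rewrite /T.
set j := (_ + (m + k - i).+2)%N.
have jE : (j = m + k - r)%N by rewrite /j; lia.
have -> : piece 1 u k i (m + k) j = interp 1 u k j r.+1.
  rewrite /piece ifF ?ifF; [|lia|lia].
  by congr interp; lia.
rewrite Rintegral_interp; [|lia..].
rewrite (_ : (m + k - j = r)%N); last by lia.
congr kmom; apply: eq_dinterp => l lk; rewrite /u; congr ((_ == _)%:R); lia.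
Qed.

(** * Explicit derivatives of the interpolants and their kernel moments *)

Lemma dinterp1 y q t : (dinterp y 1 q).[t] = y 1%N - y 0%N.
Proof.
rewrite /dinterp /Defs.lagrange horner_comp.
under eq_bigr do rewrite big_mkcond /= !big_ord_recl big_ord0 /=.
rewrite !big_ord_recl big_ord0 /= /bump /= !(addn0, add1n).
rewrite !(derivD, derivZ, derivM, derivN, derivX, derivC).
by rewrite !(hornerD, hornerZ, hornerM, hornerN, hornerX, hornerC, horner_comp); field.
Qed.

Lemma dinterp2 y q t : let x := (3 - q)%:R - t in (dinterp y 2 q).[t] =
  y 0%N * (x - 3/2) + y 1%N * (2 - 2 * x) + y 2 * (x - 1/2).
Proof.
move=> x; rewrite /dinterp /Defs.lagrange horner_comp.
under eq_bigr do rewrite big_mkcond /= !big_ord_recl big_ord0 /=.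
rewrite !big_ord_recl big_ord0 /= /bump /= !(addn0, add1n).
rewrite !(derivD, derivZ, derivM, derivN, derivX, derivC).
by rewrite !(hornerD, hornerZ, hornerM, hornerN, hornerX, hornerC, horner_comp) -/x; field.
Qed.

Lemma dinterp3 y q t : let x := (4 - q)%:R - t in (dinterp y 3 q).[t] =
  y 0%N * (- (3 * x ^+ 2 - 12 * x + 11) / 6) + y 1%N * ((3 * x ^+ 2 - 10 * x + 6) / 2)
  + y 2 * (- (3 * x ^+ 2 - 8 * x + 3) / 2) + y 3 * ((3 * x ^+ 2 - 6 * x + 2) / 6).
Proof.
move=> x; rewrite /dinterp /Defs.lagrange horner_comp.
under eq_bigr do rewrite big_mkcond /= !big_ord_recl big_ord0 /=.
rewrite !big_ord_recl big_ord0 /= /bump /= !(addn0, add1n).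
rewrite !(derivD, derivZ, derivM, derivN, derivX, derivC).
by rewrite !(hornerD, hornerZ, hornerM, hornerN, hornerX, hornerC, horner_comp) -/x; field.
Qed.

Notation kb := (kb R alpha).
Notation ke := (ke R alpha).
Notation kh := (kh R alpha).
Notation kf := (kf R alpha).

Lemma eq_kmom r p q : (forall t, p.[t] = q.[t]) -> kmom r p = kmom r q.
Proof. by move=> pq; apply: eq_Rintegral => t _; rewrite pq. Qed.

(** Change of basis: [t = 1/2 - (1/2 - t)] and [t^2 = 1/3 - 2 (1 - 3 t^2) / 6]. *)
Lemma kmom_quadE r c0 c1 c2 : kmom r (quad R c0 c1 c2) =
  c0 * kb r + c1 * (kb r / 2 - ke r) + c2 * (kb r / 3 - 2 * kh r).
Proof. by rewrite /kb /ke /kh !kmom_quad//; lra. Qed.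

Lemma kmom_dinterp1 r y q : kmom r (dinterp y 1 q) = (y 1%N - y 0%N) * kb r.
Proof.
rewrite (@eq_kmom _ _ (quad R (y 1%N - y 0%N) 0 0)); first by rewrite kmom_quadE; ring.
by move=> t; rewrite dinterp1 horner_quad; ring.
Qed.

Lemma kmom_dinterp2 r y q : let x := (3 - q)%:R in
  kmom r (dinterp y 2 q) =
  y 0%N * ((x - 2) * kb r + ke r) + y 1%N * ((3 - 2 * x) * kb r - 2 * ke r) +
  y 2 * ((x - 1) * kb r + ke r).
Proof.
move=> x; rewrite (@eq_kmom _ _ (quad R
  (y 0%N * (x - 3/2) + y 1%N * (2 - 2 * x) + y 2 * (x - 1/2))
  (- y 0%N + y 1%N * 2 - y 2) 0)); first by rewrite kmom_quadE; lra.
by move=> t; rewrite dinterp2 horner_quad -/x; ring.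
Qed.

(** Here [m c0 c1 c2] is the moment of [c0 + c1 (x - t) + c2 (x - t)^2], with [x - t] the position
    measured from the first node. *)
Lemma kmom_dinterp3 r y q : let x := (4 - q)%:R in
  let m c0 c1 c2 := (c0 + c1 * x + c2 * x ^+ 2) * kb r
    - (c1 + 2 * c2 * x) * (kb r / 2 - ke r) + c2 * (kb r / 3 - 2 * kh r) in
  kmom r (dinterp y 3 q) =
  y 0%N * m (- (11/6)) 2 (- (1/2)) + y 1%N * m 3 (-5) (3/2) +
  y 2 * m (- (3/2)) 4 (- (3/2)) + y 3 * m (1/3) (-1) (1/2).
Proof.
move=> x m; pose c0 := y 0%N * (- (11/6) + 2 * x - 1/2 * x ^+ 2) +
    y 1%N * (3 - 5 * x + 3/2 * x ^+ 2) + y 2 * (- (3/2) + 4 * x - 3/2 * x ^+ 2)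
    + y 3 * (1/3 - x + 1/2 * x ^+ 2).
pose c1 := y 0%N * (- 2 + x) + y 1%N * (5 - 3 * x) + y 2 * (- 4 + 3 * x) + y 3 * (1 - x).
pose c2 := - (1/2) * y 0%N + 3/2 * y 1%N - 3/2 * y 2 + 1/2 * y 3.
rewrite (@eq_kmom _ _ (quad R c0 c1 c2)).
  by rewrite kmom_quadE /m /c0 /c1 /c2; lra.
by move=> t; rewrite dinterp3 horner_quad -/x /c0 /c1 /c2; lra.
Qed.

(* The coefficients of [(1 - xi)^2] and [(1 - xi)^3] in [Gamma(1 - alpha) omega]
   once the quadratics are expanded on [1], [1/2 - t] and [(1 - 3 t^2)/6]. *)
Definition eseq (k i n : nat) : R :=
  if (k <= 1)%N then 0 else
  if i is 1%N then ke n else if n is 0%N then ke 0 + ke 1 else ke n.+1.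

Definition fseq (k i n : nat) : R :=
  if (k <= 2)%N then 0 else match i, n with
    | 1%N, _ => kf n
    | 2, 0%N => kf 0 - kh 1
    | 2, _ => - kh n.+1
    | _, 0%N => kf 0 - kh 1 - kh 2
    | _, _ => - kh n.+2
    end.

(** A stencil starting beyond node [k] sees only zeros, so the number of terms no longer depends on
    [m] and a single symbolic identity can treat all large [m]. *)
Lemma weight_tail k i m : (1 <= i)%N -> (i <= k)%N -> (k < m)%N ->
  weight alpha k i m = (Gamma (1 - alpha))^-1 *
   \sum_(0 <= a < k.+1)
      kmom (i.-1 + m - a) (dinterp (fun l => (a + l == k)%:R) k i).
Proof.
move=> i1 ik km; rewrite weightE//; congr (_ * _).
have z a r q : (k < a)%N -> kmom r (dinterp (fun l => (a + l == k)%:R) k q) = 0.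
  move=> ka; rewrite (@eq_dinterp _ (fun=> 0)) ?dinterp0 ?kmom0// => l _.
  by case: eqP => //; lia.
rewrite [X in _ + X]big1 ?addr0; last by move=> r _; exact: z.
rewrite (@big_cat_nat _ _ _ k.+1)//=; last by lia.
rewrite [X in _ + X]big1_seq ?addr0// => a.
by rewrite mem_index_iota => /andP[_ /andP[ka _]]; exact: z.
Qed.

(** Finitely many boundary weights [m <= k] are checked one by one and the tail symbolically; once
    the moment sequences are generalized, each case is a linear identity with rational
    coefficients. *)
Lemma weight_dif k i m : (1 <= i)%N -> (i <= k)%N -> (k <= 3)%N ->
  weight alpha k i m = (Gamma (1 - alpha))^-1 *
    (dif R kb m + dif R (dif R (eseq k i)) m + dif R (dif R (dif R (fseq k i))) m).
Proof.
move=> i1 ik k3; have [mk|mk] := leqP m k.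
  rewrite weightE//; congr (_ * _).
  move: m mk i i1 ik; case: k k3 => [|[|[|[|//]]]] // _;
    case=> [|[|[|[|//]]]] // _; case=> [|[|[|[|//]]]] // _ _;
    rewrite !(big_nat_recr, big_nil)//= ?(kmom_dinterp1, kmom_dinterp2, kmom_dinterp3);
    rewrite /dif /eseq /fseq /= ?kfE// /addn /subn /=;
    move: (kb) (ke) (kh) => b e h; rewrite ?(mul0r, mul1r, add0r, addr0, expr1n);
    by field.
rewrite weight_tail//; congr (_ * _).
move: m mk i i1 ik; case: k k3 => [|[|[|[|//]]]] // _.
- by move=> m _ [].
- move=> [//|[//|m]] _ [|[|//]] // _ _.
  rewrite !(big_nat_recr, big_nil)//= !kmom_dinterp1.
  rewrite /dif /eseq /fseq /= /addn /subn /=.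
  move: (kb) (ke) (kh) => b e h; rewrite ?(mul0r, mul1r, add0r, addr0).
  (* The third difference at [m + 2] reaches back to index [m - 1], so [m = 0] is separate. *)
  by case: m => [|m]; field.
- move=> [//|[//|[//|m]]] _ [|[|[|//]]] // _ _;
  rewrite !(big_nat_recr, big_nil)//= !kmom_dinterp2;
  rewrite /dif /eseq /fseq /= /addn /subn /=;
  by move: (kb) (ke) (kh) => b e h; rewrite ?(mul0r, mul1r, add0r, addr0); field.
- move=> [//|[//|[//|[//|m]]]] _ [|[|[|[|//]]]] // _ _;
  rewrite !(big_nat_recr, big_nil)//= !kmom_dinterp3;
  rewrite /dif /eseq /fseq /= ?kfE// /addn /subn /=;
  by move: (kb) (ke) (kh) => b e h; rewrite ?(mul0r, mul1r, add0r, addr0); field.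
Qed.

End Weights.

(** * Signs, limits and the theorem *)

Section Assembly.
Variables (R : realType) (alpha : R).
Hypothesis alpha01 : 0 < alpha < 1.
Notation kb := (kb R alpha).
Notation ke := (ke R alpha).
Notation kh := (kh R alpha).
Notation kf := (kf R alpha).
Notation eseq := (eseq R alpha).
Notation fseq := (fseq R alpha).
Notation dif := (dif R).

Let ke_dec := ke_nonincr R alpha alpha01.
Let kh_dec := kh_nonincr R alpha alpha01.
Let kf_dec := kf_nonincr R alpha alpha01.
Let ke0 := ke_ge0 R alpha alpha01.
Let kh0 := kh_ge0 R alpha alpha01.
Let kf0 := kf_ge0 R alpha alpha01.

Lemma eseq_ge0 k i n : 0 <= eseq k i n.
Proof.
rewrite /eseq; case: ifP => // _.
by case: i => [|[|i]] //; case: n => [|n] //; rewrite addr_ge0.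
Qed.

Lemma eseq_nonincr k i n : eseq k i n.+1 <= eseq k i n.
Proof.
rewrite /eseq; case: ifP => // _.
have h : ke 2 <= ke 0 + ke 1 by rewrite (le_trans (ke_dec 1))// lerDr.
by case: i => [|[|i]] //; case: n => [|n].
Qed.

Lemma cvg_eseq k i : eseq k i @ \oo --> (0 : R).
Proof.
have c : ke @ \oo --> (0 : R) by exact: cvg_kmom.
have c1 : (fun n => ke n.+1) @ \oo --> (0 : R) by rewrite (cvg_shiftS ke).
have c2 : (fun n => ke n.+2) @ \oo --> (0 : R).
  by rewrite (cvg_shiftS (fun n => ke n.+1)).
rewrite -cvg_shiftS /eseq /=; case: (k <= 1)%N; first exact: cvg_cst.
by case: i => [|[|i]]; [exact: c2|exact: c1|exact: c2].
Qed.

Lemma cvg_fseq k i : fseq k i @ \oo --> (0 : R).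
Proof.
have cf : kf @ \oo --> (0 : R) by exact: cvg_kmom.
have ch : (fun n => - kh n) @ \oo --> (0 : R).
  by rewrite -oppr0; apply: cvgN; exact: cvg_kmom.
have ch2 : (fun n => - kh n.+2) @ \oo --> (0 : R).
  by rewrite (cvg_shiftS (fun n => - kh n.+1)) (cvg_shiftS (fun n => - kh n)).
have ch3 : (fun n => - kh n.+3) @ \oo --> (0 : R).
  by rewrite (cvg_shiftS (fun n => - kh n.+2)).
rewrite -cvg_shiftS /fseq /=; case: (k <= 2)%N; first exact: cvg_cst.
case: i => [|[|[|i]]]; [exact: ch3| |exact: ch2|exact: ch3].
by rewrite (cvg_shiftS kf).
Qed.

Lemma difN (c : nat -> R) n : dif (fun n => - c n) n = - dif c n.
Proof. by case: n => [|n]; rewrite /dif ?subr0 ?opprB ?opprK 1?addrC. Qed.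

(** Isolates the leading coefficient [kf 0], at most [kb 0 / 3], from a remainder of variation [T]
    with [2 T < 1/3]; then [kb 0 >= 1] yields the strict inequality required by [psum_neq0]. *)
Lemma fseq_split k i : (1 <= i)%N -> (i <= k)%N -> (k <= 3)%N ->
  exists f0 T g, [/\
    forall n, fseq k i n = (if n is 0%N then f0 else 0) + g n,
    forall N, \sum_(0 <= n < N) `|dif g n| <= T,
    0 <= f0, 0 <= T & f0 / 2 + 2 * T < kb 0 / 2].
Proof.
move=> i1 ik k3.
have b1 := kb0_ge1 R alpha alpha01.
have f0b := kf0_le R alpha alpha01.
have h1 := kh1_lt R alpha alpha01.
have e1 := ke1_lt R alpha alpha01.
have [k2|k2] := leqP k 2; rewrite /fseq ?k2; last rewrite leqNgt k2 /=.
  exists 0, 0, (fun=> 0); split.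
  - by case=> [|n]; rewrite addr0.
  - by move=> N; rewrite big1// => -[|n] _; rewrite /dif subrr normr0.
  - by [].
  - by [].
  - by lra.
have hN (c : nat -> R) T : (forall N, \sum_(0 <= n < N) `|dif c n| <= T) ->
    forall N, \sum_(0 <= n < N) `|dif (fun n => - c n) n| <= T.
  by move=> cT N; under eq_bigr do rewrite difN normrN.
case: i i1 ik => [//|[|[|[|i]]]] _ ik; last by lia.
- exists (kf 0), (2 * kf 1), (fun n => if n is 0%N then 0 else kf n).
  have f1 : kf 1 = ke 1 - kh 1 by exact: kfE.
  split.
  + by case=> [|n]; rewrite ?addr0 ?add0r.
  + by move=> N; apply: sum_abs_dif1 => [//|n|[|n]//]; exact: kf_dec.
  + exact: kf0.
  + by rewrite mulr_ge0// kf0.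
  + move: (kh0 1) f1 b1 f0b h1 e1.
    by move: (kf 0) (kf 1) (kb 0) (kh 1) (ke 1) => *; lra.
- exists (kf 0), (2 * kh 1), (fun n => - kh n.+1); split.
  + by case=> [|n]; rewrite ?add0r.
  + apply: hN => N; apply: (sum_abs_dif R (fun n => kh n.+1)) => n.
      exact: kh_dec.
    exact: kh0.
  + exact: kf0.
  + by rewrite mulr_ge0// kh0.
  + by move: b1 f0b h1; move: (kf 0) (kb 0) (kh 1) => *; lra.
- pose c n := if n is 0%N then kh 1 + kh 2 else kh n.+2.
  have h2 := kh_dec 1; exists (kf 0), (2 * (kh 1 + kh 2)), (fun n => - c n); split.
  + by case=> [|n]; rewrite /c ?add0r// opprD addrA.
  + apply: hN => N; apply: (sum_abs_dif R c) => [] [|n]; rewrite /c.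
    * by apply: (le_trans (kh_dec 2)); rewrite lerDr kh0.
    * exact: kh_dec.
    * by rewrite addr_ge0 ?kh0.
    * exact: kh0.
  + exact: kf0.
  + by rewrite mulr_ge0// addr_ge0 ?kh0.
  + by move: b1 f0b h1 h2; move: (kf 0) (kb 0) (kh 1) (kh 2) => *; lra.
Qed.

(** * Behaviour at [xi = 1] *)

Lemma cvg_dif (c : nat -> R) : c @ \oo --> (0 : R) -> dif c @ \oo --> (0 : R).
Proof.
move=> c0; rewrite -cvg_shiftS.
have c1 : (fun n => c n.+1) @ \oo --> (0 : R) by rewrite (cvg_shiftS c).
by have h := cvgB c1 c0; rewrite subr0 in h; exact: h.
Qed.

Definition phi_coef k i n : R := kb n + dif (eseq k i) n + dif (dif (fseq k i)) n.

Lemma sum_weight k i n : (1 <= i)%N -> (i <= k)%N -> (k <= 3)%N ->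
  \sum_(0 <= m < n.+1) weight alpha k i m =
  (Gamma (1 - alpha))^-1 * phi_coef k i n.
Proof.
move=> i1 ik k3.
under eq_bigr do rewrite weight_dif//.
by rewrite -big_distrr/= 2!big_split/= !sum_dif.
Qed.

Lemma cvg_sum_weight k i : (1 <= i)%N -> (i <= k)%N -> (k <= 3)%N ->
  series (weight alpha k i) @ \oo --> (0 : R).
Proof.
move=> i1 ik k3; rewrite -cvg_shiftS /series/=.
under eq_fun do rewrite sum_weight//.
have cb := cvg_kb R alpha alpha01.
have ce := cvg_dif _ (cvg_eseq k i).
have cf := cvg_dif _ (cvg_dif _ (cvg_fseq k i)).
have h : (fun n => (Gamma (1 - alpha))^-1 * phi_coef k i n) @ \oo -->
    (Gamma (1 - alpha))^-1 * (0 + 0 + 0).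
  by apply: cvgMr; exact: cvgD (cvgD cb ce) cf.
by rewrite !addr0 mulr0 in h.
Qed.

Lemma not_cvg_sum_phi k i : (1 <= i)%N -> (i <= k)%N -> (k <= 3)%N ->
  ~ (series (fun n => \sum_(0 <= m < n.+1) weight alpha k i m) @ \oo --> (0 : R)).
Proof.
move=> i1 ik k3; under eq_fun do rewrite sum_weight//.
rewrite -cvg_shiftS /series/= => h.
have G0 := Gamma_neq0 R alpha alpha01.
have sE N : \sum_(0 <= n < N.+1) (Gamma (1 - alpha))^-1 * phi_coef k i n =
    (Gamma (1 - alpha))^-1 *
    (\sum_(0 <= n < N.+1) kb n + eseq k i N + dif (fseq k i) N).
  by rewrite -big_distrr/= /phi_coef 2!big_split/= !sum_dif.
(* If the sums of [phi] tended to 0, removing the factor and the two vanishing terms would make the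
   sums of [kb] tend to 0, although they are at least [kb 0 >= 1]. *)
have hb : (fun N => \sum_(0 <= n < N.+1) kb n) @ \oo --> Gamma (1 - alpha) * 0 - 0 - 0.
  have -> : (fun N => \sum_(0 <= n < N.+1) kb n) = (fun N => Gamma (1 - alpha) *
     (\sum_(0 <= n < N.+1) (Gamma (1 - alpha))^-1 * phi_coef k i n)
     - eseq k i N - dif (fseq k i) N).
    by apply/funext => N; rewrite sE mulrA divff// mul1r; ring.
  have ce := cvg_eseq k i.
  have cf := cvg_dif _ (cvg_fseq k i).
  by apply: cvgB cf; apply: cvgB ce; apply: cvgMr; exact: h.
rewrite mulr0 !subr0 in hb.
suff : (1 : R) <= 0 by rewrite leNgt ltr01.
rewrite -[leRHS](cvg_lim _ hb)//; apply: limr_ge; first exact: cvgP hb.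
apply: nearW => N; apply: le_trans (kb0_ge1 R alpha alpha01) _.
rewrite big_nat_recl//= lerDl; apply: sumr_ge0 => n _; exact: kb_ge0.
Qed.

(** * Passage from real coordinates to complex series *)

Lemma powpairE (xi : R[i]) n :
  xi ^+ n = ((powpair R (complex.Re xi) (complex.Im xi) n).1
     +i* (powpair R (complex.Re xi) (complex.Im xi) n).2)%C.
Proof.
elim: n => [|n IH]; first by rewrite expr0.
by rewrite exprS IH powpair_re powpair_im; case: xi {IH} => a b.
Qed.

Lemma cvg_psum_complex (xi : R[i]) (x : nat -> R) (X Y : R) :
  psum R (complex.Re xi) (complex.Im xi) x X Y ->
  series (fun m => (((x m)%:C)%C * xi ^+ m : R[i]^o)) @ \oo --> ((X +i* Y)%C : R[i]^o).
Proof.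
move=> [hX hY]; apply/cvgrPdist_le => eps eps0.
(* The radius is a positive element of [R[i]], hence real; an error of half of it in each coordinate
   gives a squared norm at most half of its square. *)
have epsE : eps = ((complex.Re eps)%:C)%C.
  by rewrite RRe_real// realE ltW.
have e0 : 0 < complex.Re eps by move: eps0; rewrite ltcE => /andP[].
move: hX hY => /cvgrPdist_le /(_ (complex.Re eps / 2)) hX
  /cvgrPdist_le /(_ (complex.Re eps / 2)) hY.
have e20 : 0 < complex.Re eps / 2 by rewrite divr_gt0.
have sE N : series (fun m => (((x m)%:C)%C * xi ^+ m : R[i]^o)) N =
   (series (fun n => x n * (powpair R (complex.Re xi) (complex.Im xi) n).1) N
    +i* series (fun n => x n * (powpair R (complex.Re xi) (complex.Im xi) n).2) N)%C.
  rewrite /series/=; elim: N => [|N IH]; first by rewrite !big_nil.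
  rewrite !big_nat_recr//= IH powpairE.
  by apply/eqP; rewrite eq_complex/= !mul0r subr0 addr0 !eqxx.
near=> N.
have dX : `|X - series (fun n => x n * (powpair R (complex.Re xi) (complex.Im xi) n).1) N|
    <= complex.Re eps / 2 by near: N; exact: hX.
have dY : `|Y - series (fun n => x n * (powpair R (complex.Re xi) (complex.Im xi) n).2) N|
    <= complex.Re eps / 2 by near: N; exact: hY.
rewrite sE epsE; move: (series _ N) (series _ N) dX dY => SY SX dX dY.
suff : `|((X - SX) +i* (Y - SY))%C : R[i]| <= ((complex.Re eps)%:C)%C by [].
rewrite normc_def lecR.
rewrite -(@ler_pXn2r _ 2%N) ?nnegrE ?sqrtr_ge0 ?(ltW e0)//.
rewrite sqr_sqrtr ?addr_ge0 ?sqr_ge0//=.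
have sq (u : R) : `|u| <= complex.Re eps / 2 -> u ^+ 2 <= (complex.Re eps / 2) ^+ 2.
  move=> uE; rewrite -(real_normK (num_real u)).
  by rewrite ler_pXn2r ?nnegrE// ltW.
have := sq _ dX; have := sq _ dY; have := sqr_ge0 (complex.Re eps); lra.
Unshelve. all: by end_near. Qed.

End Assembly.

Theorem theorem3p12 (R : realType) (alpha : R) (k i : nat) :
  0 < alpha < 1 -> (1 <= i)%N -> (i <= k)%N -> (k <= 3)%N ->
  (* (i) omega^{(k,i)}(xi) converges and is nonzero for |xi| <= 1, xi <> 1 *)
  (forall xi : R[i], `|xi| <= 1 -> xi != 1 ->
     exists l : R[i]^o,
       series (fun m => (((weight alpha k i m)%:C)%C * xi ^+ m : R[i]^o)) @ \oo --> l
       /\ l != 0)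
  (* (ii) omega^{(k,i)}(1) = 0 ... *)
  /\ (series (weight alpha k i) @ \oo --> (0 : R))
  (* ... and sum_n phi_n, phi_n = sum_{m<=n} omega_m, does not converge to 0 *)
  /\ ~ (series (fun n => \sum_(0 <= m < n.+1) weight alpha k i m) @ \oo --> (0 : R)).

Proof.
move=> alpha01 i1 ik k3; split; last first.
  by split; [exact: cvg_sum_weight|exact: not_cvg_sum_phi].
move=> xi xi1 xiN1.
have ab1 : complex.Re xi ^+ 2 + complex.Im xi ^+ 2 <= 1.
  have : `|xi| ^+ 2 <= 1 by rewrite exprn_ile1.
  by rewrite -add_Re2_Im2 -[X in _ <= X]/((1 : R)%:C)%C lecR.
have abN1 : (complex.Re xi, complex.Im xi) != (1, 0).
  apply: contra xiN1 => /eqP[a1 b0].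
  by rewrite eq_complex/= a1 b0 !eqxx.
have [f0 [T [g [fE gT f00 T0 fT]]]] := @fseq_split R alpha alpha01 k i i1 ik k3.
have [X [Y [hXY XY0]]] := @psum_neq0 R _ _ ab1 (kb R alpha) (eseq R alpha k i)
  (fseq R alpha k i) g f0 T abN1 (kb_nonincr R alpha alpha01)
  (kb_ge0 R alpha) (kb_convex R alpha alpha01) (eseq_nonincr R alpha alpha01 k i)
  (eseq_ge0 R alpha alpha01 k i) fE gT f00 T0 fT.
(* The factor omitted from the coefficient sequences is restored; being nonzero, it preserves
   nonvanishing. *)
have := @psumZ R _ _ _ (Gamma (1 - alpha))^-1 _ _ hXY.
set G := (Gamma (1 - alpha))^-1 => hw.
have G0 : G != 0 by rewrite invr_eq0 Gamma_neq0.
exists ((G * X) +i* (G * Y))%C; split.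
  apply: cvg_psum_complex; move: hw; congr psum; apply/funext => m.
  by rewrite weight_dif.
apply: contra XY0; rewrite eq_complex/= !mulf_eq0 (negbTE G0)/=.
by move=> /andP[/eqP -> /eqP ->].
Qed.
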